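(* Let $S_1$ and $S_2$ be two independent nonnegative random variables with unbounded support, with distributions $S_1\sim H_1$ and $S_2\sim H_2$. Let $H$ be the distribution of the product $S_1\cdot S_2$. 1. If there exist $\theta>0$ and a nonnegative function $\xi(x)$ such that $$\limsup_{x\to\infty} e^{\theta x}\Big(\overline{H}_1(x/\xi(x))+\overline{H}_2(\xi(x))\Big)=0,$$ then $H$ is a light-tailed distribution. 2. If there exists a nonnegative function $\xi(x)$ such that for all $\theta>0$ $$\limsup_{x\to\infty} e^{\theta x}\,\overline{H}_1(x/\xi(x))\cdot\overline{H}_2(\xi(x))=\infty,$$ then $H$ is a heavy-tailed distribution.
   Context: For a distribution (function) $H$ on $[0,\infty)$, $\overline{H}(s)=1-H(s)$ denotes its tail probability. ''Unbounded support'' means $\overline{H}_i(s)>0$ for all $s\ge 0$. A nonnegative distribution $H$ is heavy-tailed if $\limsup_{s\to\infty}\overline{H}(s)e^{\theta s}=\infty$ for all $\theta>0$; otherwise $H$ is light-tailed. At points $x>0$ where $\xi(x)=0$, the quotient $x/\xi(x)$ is read as $+\infty$ and $\overline{H}_1(+\infty)=0$. *)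

(* Defs.v *)
From HB Require Import structures.
From mathcomp Require Import all_boot all_order all_algebra.
From mathcomp Require Import all_classical all_reals all_analysis.

Set Implicit Arguments.
Unset Strict Implicit.
Unset Printing Implicit Defensive.

Import Order.TTheory GRing.Theory Num.Theory.
Import numFieldNormedType.Exports.

Local Open Scope classical_set_scope.
Local Open Scope ring_scope.

(* The argument is extended so that the tail is defined, and null, at [+oo]. *)
Definition tail (R : realType) (H : probability R R) (s : \bar R) : \bar R :=
  H [set y : R | (s < y%:E)%E].

Lemma tail_cdf (R : realType) (H : probability R R) (s : R) :
  tail H s%:E = (1 - H `]-oo, s]%classic)%E.
Proof.
rewrite -probability_setC// setCitvl; congr (H _).
by apply/seteqP; split=> y /=; rewrite in_itv/= lte_fin andbT.
Qed.

Lemma tail_pinfty (R : realType) (H : probability R R) : tail H +oo%E = 0%E.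
Proof.
rewrite /tail (_ : [set y : R | _] = set0) ?measure0//.
by apply/seteqP; split=> y //=; rewrite ltNge leey.
Qed.

Definition unbounded_support (R : realType) (H : probability R R) : Prop :=
  forall s : R, 0 <= s -> (0 < tail H s%:E)%E.

(* Heavy- and light-tailedness are only meaningful for distributions
   concentrated on [0, +oo[; this is not recorded in the definitions. *)
Definition heavy_tailed (R : realType) (H : probability R R) : Prop :=
  forall theta : R, 0 < theta ->
    limf_esup (fun s : R => tail H s%:E * (expR (theta * s))%:E)%E +oo = +oo%E.

Definition light_tailed (R : realType) (H : probability R R) : Prop :=
  ~ heavy_tailed H.

Definition independent_rv (d : measure_display) (T : measurableType d)
    (R : realType) (P : probability T R) (X Y : {RV P >-> R}) : Prop :=
  forall A B : set R, measurable A -> measurable B ->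
    P (X @^-1` A `&` Y @^-1` B) = (P (X @^-1` A) * P (Y @^-1` B))%E.

Definition nonneg_rv (d : measure_display) (T : measurableType d)
    (R : realType) (P : probability T R) (X : {RV P >-> R}) : Prop :=
  {ae P, forall t, 0 <= X t}.

Lemma measurable_prod_rv (d : measure_display) (T : measurableType d)
    (R : realType) (P : probability T R) (X Y : {RV P >-> R}) :
  measurable_fun [set: T] (X \* Y : T -> R).
Proof.
by apply: measurable_realfun.measurable_funM; exact: measurable_funPT.
Qed.

Definition prod_rv (d : measure_display) (T : measurableType d)
    (R : realType) (P : probability T R) (X Y : {RV P >-> R}) :
    {RV P >-> R} :=
  HB.pack (X \* Y : T -> R)
    (isMeasurableFun.Build _ _ _ _ _ (measurable_prod_rv X Y)).

(* Main.v *)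
Require Import Defs.
From HB Require Import structures.
From mathcomp Require Import all_boot all_order all_algebra.
From mathcomp Require Import all_classical all_reals all_analysis.

(** For [x > 0] and a threshold [c >= 0], write [x = (x / c) * c].  A product
    of nonnegative factors can only exceed [x] if the first factor exceeds
    [x / c] or the second exceeds [c]; conversely it does exceed [x] as soon
    as both happen.  Taking probabilities with [c = xi x], by subadditivity in
    the first case and independence in the second, sandwiches the tail of the
    product:
      [H1(x / xi x) * H2(xi x) <= H(x) <= H1(x / xi x) + H2(xi x)]
    (tails meant throughout; see [tail_prod_rv_ge] and [tail_prod_rv_le]).
    Multiplying by [expR (theta * x)] and passing to the limit superior, which
    is monotone for eventual inequalities ([limf_esup_le_near]), the right-hand
    bound gives a [theta] for which the limit superior of
    [H(x) * expR (theta * x)] is at most [0], so that it is not [+oo],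
    and the left-hand bound makes it [+oo] for every [theta]. *)

Set Implicit Arguments.
Unset Strict Implicit.
Unset Printing Implicit Defensive.

Import Order.TTheory GRing.Theory Num.Theory.
Import numFieldNormedType.Exports.

Local Open Scope classical_set_scope.
Local Open Scope ring_scope.

Lemma limf_esup_le_near (T : choiceType) (X : filteredType T) (R : realType)
    (f g : X -> \bar R) (F : set_system X) {FF : Filter F} :
  (\forall x \near F, f x <= g x)%E -> (limf_esup f F <= limf_esup g F)%E.
Proof.
move=> fg; rewrite !limf_esupE; apply: le_ereal_inf_tmp => _ [A FA <-].
(* A set of the filter only helps once cut down to where [f <= g]. *)
apply: (@le_trans _ _ (ereal_sup (f @` (A `&` [set x | (f x <= g x)%E])))).
  by apply: ereal_inf_lbound; exists (A `&` [set x | (f x <= g x)%E]) => //;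
    exact: filterI.
apply: ge_ereal_sup => _ [x [Ax fgx] <-].
by apply: (le_trans fgx); apply: ereal_sup_ubound; exists x.
Qed.

Section threshold.
Variable R : realType.
Implicit Types a b c x : R.

(** For [c = 0] the quotient is [+oo] and the first premise is void. *)
Lemma lt_mul_of_threshold x c a b : 0 < x -> 0 <= c ->
  (x%:E / c%:E < a%:E)%E -> c < b -> x < a * b.
Proof.
move=> x0; rewrite le_eqVlt => /predU1P[<-|c0].
  by rewrite inve0 gt0_muley ?lte_fin// ltNge leey.
rewrite inver gt_eqF// -EFinM lte_fin ltr_pdivrMr// => xac cb.
have a0 : 0 < a by rewrite -(pmulr_lgt0 _ c0) (lt_trans x0).
by rewrite (lt_trans xac)// ltr_pM2l.
Qed.

(** For [c = 0] it is the second alternative that holds, since a positive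
    product has no zero factor. *)
Lemma threshold_of_lt_mul x c a b : 0 < x -> 0 <= c -> 0 <= a -> 0 <= b ->
  x < a * b -> (x%:E / c%:E < a%:E)%E \/ c < b.
Proof.
move=> x0 c0 a0 b0 xab; case: (ltP c b) => [|bc]; [by right|left].
move: c0; rewrite le_eqVlt => /predU1P[c0|c0].
  have b00 : b = 0 by apply/eqP; rewrite eq_le b0 c0 bc.
  by move: xab; rewrite b00 mulr0 ltNge ltW.
rewrite inver gt_eqF// -EFinM lte_fin ltr_pdivrMr//.
by rewrite (lt_le_trans xab)// ler_wpM2l.
Qed.

End threshold.

(** The factors are nonnegative only almost surely, so the inclusion of events
    behind the upper bound may fail on a null set. *)
Lemma le_measure_ae (d : measure_display) (T : measurableType d) (R : realType)
    (mu : {measure set T -> \bar R}) (A B : set T) :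
  measurable A -> measurable B -> {ae mu, forall t, A t -> B t} ->
  (mu A <= mu B)%E.
Proof.
move=> mA mB [N [mN N0 ABN]]; rewrite -(measureU0 mB mN N0).
apply: le_measure; rewrite ?inE//; first exact: measurableU.
move=> t At; have [Bt|nBt] := pselect (B t); [by left|right].
by apply: ABN => /(_ At).
Qed.

Section tail_of_product.
Context (d : measure_display) (T : measurableType d) (R : realType).
Variable P : probability T R.
Implicit Types X Y : {RV P >-> R}.

Let measurable_gt (s : \bar R) : measurable [set y : R | (s < y%:E)%E].
Proof.
rewrite -[X in measurable X]setTI.
by apply: measurable_realfun.emeasurable_fun_o_infty => //;
  exact: measurable_realfun.EFin_measurable.
Qed.

Let measurable_preimage_gt X (s : \bar R) :
  measurable (X @^-1` [set y : R | (s < y%:E)%E]).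
Proof.
by rewrite -[X in measurable X]setTI; apply: measurable_funPT.
Qed.

Let tail_distribution X (s : \bar R) :
  tail (distribution P X) s = P (X @^-1` [set y : R | (s < y%:E)%E]).
Proof. by []. Qed.

(** Union bound: a product above [x] forces [X] above [x / c] or [Y] above
    [c], whatever the dependence between [X] and [Y]. *)
Lemma tail_prod_rv_le X Y (x c : R) : nonneg_rv X -> nonneg_rv Y ->
  0 < x -> 0 <= c ->
  (tail (distribution P (prod_rv X Y)) x%:E <=
   tail (distribution P X) (x%:E / c%:E) + tail (distribution P Y) c%:E)%E.
Proof.
move=> X0 Y0 x0 c0; rewrite !tail_distribution.
pose A := X @^-1` [set y | (x%:E / c%:E < y%:E)%E].
pose B := Y @^-1` [set y | (c%:E < y%:E)%E].
have mA : measurable A by exact: measurable_preimage_gt.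
have mB : measurable B by exact: measurable_preimage_gt.
apply: (le_trans _ (measureU2 P mA mB)); apply: le_measure_ae.
- exact: (measurable_preimage_gt (prod_rv X Y)).
- exact: measurableU.
- near=> t; rewrite /A /B /= !lte_fin; apply: threshold_of_lt_mul => //.
  + by near: t.
  + by near: t.
Unshelve. all: by end_near.
Qed.

(** By independence the left-hand side is the probability that [X] exceeds
    [x / c] and [Y] exceeds [c] simultaneously, an event on which the product
    exceeds [x]. *)
Lemma tail_prod_rv_ge X Y (x c : R) : independent_rv X Y ->
  0 < x -> 0 <= c ->
  (tail (distribution P X) (x%:E / c%:E) * tail (distribution P Y) c%:E <=
   tail (distribution P (prod_rv X Y)) x%:E)%E.
Proof.
move=> indep x0 c0; rewrite !tail_distribution -indep//.
apply: le_measure; [apply: mem_set|apply: mem_set|].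
- by apply: measurableI; apply: measurable_preimage_gt.
- exact: (measurable_preimage_gt (prod_rv X Y)).
- move=> t [/= Xt Yt]; rewrite lte_fin.
  by apply: (lt_mul_of_threshold x0 c0 Xt); rewrite -lte_fin.
Qed.

End tail_of_product.

(* [x%:E / 0%:E] is [+oo] in [\bar R] when [0 < x]. *)
Theorem theorem3p1 (d : measure_display) (T : measurableType d) (R : realType)
    (P : probability T R) (S1 S2 : {RV P >-> R})
    (S1_ge0 : nonneg_rv S1) (S2_ge0 : nonneg_rv S2)
    (indep : independent_rv S1 S2)
    (unb1 : unbounded_support (distribution P S1))
    (unb2 : unbounded_support (distribution P S2)) :
  let H1 : probability R R := distribution P S1 in
  let H2 : probability R R := distribution P S2 in
  let H : probability R R := distribution P (prod_rv S1 S2) in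
  ((exists theta : R, 0 < theta /\
      exists xi : R -> R, (forall x, 0 <= x -> 0 <= xi x) /\
        limf_esup (fun x : R =>
          (expR (theta * x))%:E *
            (tail H1 (x%:E / (xi x)%:E) + tail H2 (xi x)%:E))%E +oo = 0%E) ->
    light_tailed H) /\
  ((exists xi : R -> R, (forall x, 0 <= x -> 0 <= xi x) /\
      forall theta : R, 0 < theta ->
        limf_esup (fun x : R =>
          (expR (theta * x))%:E *
            tail H1 (x%:E / (xi x)%:E) * tail H2 (xi x)%:E)%E +oo = +oo%E) ->
    heavy_tailed H).
Proof.
move=> H1 H2 H; split.
  move=> [theta [theta0 [xi [xi0 lim0]]]] heavy.
  suff : (limf_esup (fun s : R => tail H s%:E * (expR (theta * s))%:E)
          +oo%R <= 0)%E by rewrite heavy.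
  rewrite -lim0; apply: limf_esup_le_near; near=> x.
  have x0 : 0 < x by near: x; exact: nbhs_pinfty_gt.
  rewrite muleC lee_wpmul2l ?lee_fin ?expR_ge0//.
  exact: (tail_prod_rv_le _ _ x0 (xi0 _ (ltW x0))).
move=> [xi [xi0 limy]] theta theta0; apply/eqP; rewrite -leye_eq.
rewrite -(limy theta theta0); apply: limf_esup_le_near; near=> x.
have x0 : 0 < x by near: x; exact: nbhs_pinfty_gt.
rewrite -muleA [leRHS]muleC lee_wpmul2l ?lee_fin ?expR_ge0//.
exact: (tail_prod_rv_ge indep x0 (xi0 _ (ltW x0))).
Unshelve. all: by end_near.
Qed.
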